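(* Let $\mathcal{C}$ be a complete $d$-partite $d$-uniform clutter on $[n]$ with $d$-partition $\{V_i : i\in[d]\}$. Then $$\mathcal{R}_R(I(\mathcal{C}))\simeq \frac{R[T_e : e\in\mathcal{C}]}{\mathcal{A}}$$ where $\mathcal{A}$ is generated by the set of all binomials of the form $T_ex_i-x_rT_{e(i)}$ with $e\in\mathcal{C}$, $i\in[n]\setminus e$ and $r=v_e(i)$, together with those of the form $T_eT_{e'}-T_{e(j')}T_{e'(j)}$ where $j=v(e,e')$ and $j'=v(e',e)$, for $e\neq e'\in\mathcal{C}$ with $|e'\setminus e|>1$. In particular, the circuit ideal of a complete $d$-partite $d$-uniform clutter is of fiber type.
   Context: Let $k$ be an algebraically closed field, $R=k[x_1,\ldots,x_n]$, $[n]=\{1,\ldots,n\}$. A clutter $\mathcal{C}$ on $[n]$ is a family of subsets of $[n]$ (called circuits), pairwise incomparable under inclusion; it is $d$-uniform if all circuits have cardinality $d$ ($d$ a positive integer). A $d$-uniform clutter is complete $d$-partite with $d$-partition $\{V_i: i\in[d]\}$ if $[n]$ is the union of the mutually disjoint sets $V_1,\ldots,V_d$, each circuit meets each $V_i$ in at most one vertex, and $\mathcal{C}$ contains all $d$-subsets of $[n]$ meeting each $V_i$ in at most one vertex. For $F\subseteq[n]$, $\mathbf{x}_F=\prod_{i\in F}x_i$, and $I(\mathcal{C})=(\mathbf{x}_F: F\in\mathcal{C})$ is the circuit ideal. For $e\in\mathcal{C}$ and a vertex $j\in[n]$, $v_e(j)$ is the only vertex of $e$ lying in the same part of the partition as $j$,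 and $e(j)=(e\setminus\{v_e(j)\})\cup\{j\}$ is the circuit of $\mathcal{C}$ obtained from $e$ by replacing $v_e(j)$ with $j$. For all $e\neq e'$ in $\mathcal{C}$ one vertex $v(e,e')\in e\setminus e'$ is fixed, in such a way that $v(e,e')$ and $v(e',e)$ lie in the same part of the partition. The Rees algebra of an ideal $I$ is $\mathcal{R}_R(I)=\bigoplus_{i\ge 0}I^it^i\subseteq R[t]$. For $I=(f_1,\ldots,f_m)$, let $S=R[T_1,\ldots,T_m]$, let $\mathcal{J}$ be the kernel of the $R$-algebra map $S\to\mathcal{R}_R(I)$, $T_i\mapsto f_it$, which is graded by degree in the $T_i$, let $\mathcal{J}_1$ be its component of degree one in the $T_i$, and let $\mathcal{H}$ be the kernel of the $k$-algebra map $k[T_1,\ldots,T_m]\to k[f_1,\ldots,f_m]$, $T_i\mapsto f_i$. The ideal $I$ is of fiber type if $\mathcal{J}=S\mathcal{J}_1+S\mathcal{H}$.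
   Formalization: The isomorphism is stated for some suitable choice of the vertices v(e,e'), not for every admissible choice: for d=3 and parts of size 2, choosing the vertex in the last part where e and e' differ makes 𝒜 too small. *)

(* Defs.v *)
From HB Require Import structures.
From mathcomp Require Import all_boot all_order all_algebra.
From mathcomp Require Export ring_quotient generic_quotient.
From mathcomp Require Import boolp mpoly.

Set Implicit Arguments.
Unset Strict Implicit.
Unset Printing Implicit Defensive.

Import GRing.Theory.

Local Open Scope ring_scope.
Local Open Scope quotient_scope.

(* -------------------------------------------------------------------- *)
Section GeneratedIdeal.
Variable A : comNzRingType.
Implicit Types (G I : A -> Prop) (p q : A).

Definition gen_ideal G p : Prop :=
  exists2 s : seq (A * A), (forall x, x \in s -> G x.2)
    & p = \sum_(x <- s) x.1 * x.2.

Lemma gen_ideal0 G : gen_ideal G 0.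
Proof. by exists [::]; rewrite // big_nil. Qed.

Lemma gen_idealD G p q : gen_ideal G p -> gen_ideal G q -> gen_ideal G (p + q).
Proof.
move=> [s Gs ->] [t Gt ->]; exists (s ++ t); last by rewrite big_cat.
by move=> x; rewrite mem_cat => /orP[/Gs|/Gt].
Qed.

Lemma gen_idealM G a p : gen_ideal G p -> gen_ideal G (a * p).
Proof.
move=> [s Gs ->]; exists [seq (a * x.1, x.2) | x <- s].
  by move=> _ /mapP[x /Gs Gx ->].
by rewrite big_map mulr_sumr; apply: eq_bigr => x _; rewrite mulrA.
Qed.

Lemma gen_ideal_gen G p : G p -> gen_ideal G p.
Proof.
move=> Gp; exists [:: (1, p)]; last by rewrite big_seq1 mul1r.
by move=> x; rewrite inE => /eqP ->.
Qed.

Lemma gen_ideal_ind G (P : A -> Prop) :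
  P 0 -> (forall p q, P p -> P q -> P (p + q)) ->
  (forall a g, G g -> P (a * g)) -> forall p, gen_ideal G p -> P p.
Proof.
move=> P0 PD PM p [s Gs ->]; elim: s Gs => [|x s IHs] Gs.
  by rewrite big_nil.
rewrite big_cons; apply: PD; first by apply/PM/Gs; rewrite inE eqxx.
by apply: IHs => y ys; apply: Gs; rewrite inE ys orbT.
Qed.

Fixpoint ideal_pow I (i : nat) : A -> Prop :=
  if i is j.+1 then
    gen_ideal (fun p => exists a b, [/\ I a, ideal_pow I j b & p = a * b])
  else fun _ => True.

Lemma ideal_pow0 I i : ideal_pow I i 0.
Proof. by case: i => [|i] //=; apply: gen_ideal0. Qed.

Lemma ideal_powD I i p q :
  ideal_pow I i p -> ideal_pow I i q -> ideal_pow I i (p + q).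
Proof. by case: i => [|i] //=; apply: gen_idealD. Qed.

Lemma ideal_powM I i a p : ideal_pow I i p -> ideal_pow I i (a * p).
Proof. by case: i => [|i] //=; apply: gen_idealM. Qed.

Lemma ideal_powMD I i j p q :
  ideal_pow I i p -> ideal_pow I j q -> ideal_pow I (i + j) (p * q).
Proof.
elim: i p => [|i IHi] p /=; first by move=> _; apply: ideal_powM.
move=> Ip Iq; move: p Ip; apply: gen_ideal_ind.
- by rewrite mul0r; apply: gen_ideal0.
- by move=> p p' Ip Ip'; rewrite mulrDl; apply: gen_idealD.
- move=> a _ [u [w [Iu Iw ->]]]; rewrite -mulrA; apply: gen_idealM.
  apply: gen_ideal_gen; exists u, (w * q); split=> //; first exact: IHi.
  by rewrite mulrA.
Qed.

(* The Rees algebra, as a subalgebra of A[t] = {poly A}. *)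
Definition rees_pred I : {pred {poly A}} :=
  fun p : {poly A} => `[< forall i, ideal_pow I i p`_i >].

Lemma rees_subalg_closed I : subalg_closed (rees_pred I).
Proof.
split.
- apply/asboolP => i; rewrite coef1.
  by case: i => [|i] //=; apply: gen_ideal0.
- move=> a p q /asboolP Ip /asboolP Iq; apply/asboolP => i.
  by rewrite coefD coefZ; apply: ideal_powD => //; apply: ideal_powM.
- move=> p q /asboolP Ip /asboolP Iq; apply/asboolP => i.
  rewrite coefM; apply: (big_ind (ideal_pow I i)).
  + exact: ideal_pow0.
  + exact: ideal_powD.
  + by move=> j _; rewrite -[X in ideal_pow I X](subnKC (leq_ord j));
      apply: ideal_powMD.
Qed.

HB.instance Definition _ I :=
  GRing.isSubalgClosed.Build A {poly A} (rees_pred I) (rees_subalg_closed I).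

Record rees_algebra I := ReesAlgebra {
  rees_val :> {poly A};
  _ : rees_val \in rees_pred I
}.

HB.instance Definition _ I := [isSub for @rees_val I].
HB.instance Definition _ I := [Choice of rees_algebra I by <:].
HB.instance Definition _ I :=
  [SubChoice_isSubComNzRing of rees_algebra I by <:].
HB.instance Definition _ I :=
  [SubZmodule_isSubLmodule of rees_algebra I by <:].
HB.instance Definition _ I :=
  [SubNzRing_SubLmodule_isSubLalgebra of rees_algebra I by <:].

End GeneratedIdeal.

(* -------------------------------------------------------------------- *)
(* The algebra structure of the quotient of a commutative algebra by an
   ideal; ring_quotient only provides the ring structure. *)
Section QuotientAlgebra.
Variables (K : comNzRingType) (B : comAlgType K) (I : idealr B).

Definition quot_scale (a : K) (q : {ideal_quot I}) : {ideal_quot I} :=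
  \pi_({ideal_quot I}) (a *: repr q).

Lemma pi_scale (a : K) (x : B) :
  \pi_({ideal_quot I}) (a *: x) = quot_scale a (\pi_({ideal_quot I}) x).
Proof.
apply/eqP; rewrite -Quotient.idealrBE -scalerBr -mulr_algl.
by apply: idealMr; rewrite Quotient.idealrBE reprK.
Qed.

Lemma quot_scaleA a b q :
  quot_scale a (quot_scale b q) = quot_scale (a * b) q.
Proof. by rewrite -[q]reprK -!pi_scale scalerA reprK. Qed.

Lemma quot_scale1 : left_id 1 quot_scale.
Proof. by move=> q; rewrite -[q]reprK -pi_scale scale1r. Qed.

Lemma quot_scaleDr : right_distributive quot_scale +%R.
Proof.
move=> a q r; rewrite -[q]reprK -[r]reprK -rmorphD -!pi_scale.
by rewrite scalerDr rmorphD.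
Qed.

Lemma quot_scaleDl q : {morph quot_scale^~ q : a b / a + b}.
Proof. by move=> a b; rewrite -[q]reprK -!pi_scale scalerDl rmorphD. Qed.

HB.instance Definition _ := GRing.Zmodule_isLmodule.Build K {ideal_quot I}
  quot_scaleA quot_scale1 quot_scaleDr quot_scaleDl.

Lemma quot_scaleAl (a : K) (q r : {ideal_quot I}) :
  a *: (q * r) = (a *: q) * r.
Proof.
have aE x : a *: \pi_({ideal_quot I}) x = \pi_({ideal_quot I}) (a *: x).
  by rewrite pi_scale.
by rewrite -[q]reprK -[r]reprK -rmorphM !aE -rmorphM scalerAl.
Qed.

HB.instance Definition _ :=
  GRing.Lmodule_isLalgebra.Build K {ideal_quot I} quot_scaleAl.

End QuotientAlgebra.

(* -------------------------------------------------------------------- *)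
(* For f_0, ..., f_{m-1} in R = k[x_0, ..., x_{n-1}], S = R[T_0, ..., T_{m-1}] *)
Section FiberType.
Variables (k : closedFieldType) (n m : nat) (f : 'I_m -> {mpoly k[n]}).
Local Notation R := {mpoly k[n]}.
Local Notation S := {mpoly R[m]}.

Definition rees_map (p : S) : {poly R} := mmap polyC (fun i => f i *: 'X) p.

Definition rees_ker (p : S) : Prop := rees_map p = 0.

Definition rees_ker1 (p : S) : Prop :=
  rees_ker p /\ p \is 1.-homog.

(* the kernel of k[T] -> R, whose image is k[f_0, ..., f_{m-1}] *)
Definition fiber_ker (h : {mpoly k[m]}) : Prop := mmap (@mpolyC n k) f h = 0.

Definition fiber_ker_ext (p : S) : Prop :=
  exists2 h, fiber_ker h & p = map_mpoly (@mpolyC n k) h.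

Definition fiber_type : Prop :=
  forall p : S, rees_ker p <->
    exists a b, [/\ gen_ideal rees_ker1 a, gen_ideal fiber_ker_ext b
                  & p = a + b].

End FiberType.

(* -------------------------------------------------------------------- *)
Section Clutter.
Variables (n d : nat).
Implicit Types (C : {set {set 'I_n}}) (V : 'I_d -> {set 'I_n}).

Definition is_clutter C := {in C &, forall e f : {set 'I_n}, e \subset f -> e = f}.

Definition uniform C := {in C, forall e : {set 'I_n}, #|e| = d}.

Definition transversal V (e : {set 'I_n}) := forall p, (#|e :&: V p| <= 1)%N.

Definition complete_partite C V :=
  [/\ \bigcup_p V p = [set: 'I_n],
      forall p q, p != q -> [disjoint V p & V q],
      {in C, forall e, transversal V e}
    & forall e : {set 'I_n}, #|e| = d -> transversal V e -> e \in C].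

Definition same_part V (x y : 'I_n) : bool :=
  [exists p, (x \in V p) && (y \in V p)].

End Clutter.

Notation circuit C := {e | e \in C}.

Section Exchange.
Variables (n d : nat) (C : {set {set 'I_n}}) (V : 'I_d -> {set 'I_n}).

(* v_e(j); the default value j is never used, see [vert_in]. *)
Definition vert (e : circuit C) (j : 'I_n) : 'I_n :=
  odflt j [pick x in val e | same_part V x j].

(* e(j); the default value e is never used, see [val_exch]. *)
Definition exch (e : circuit C) (j : 'I_n) : circuit C :=
  insubd e (j |: (val e :\ vert e j)).

Definition vertex_choice (v : circuit C -> circuit C -> 'I_n) :=
  forall e e', e != e' ->
    v e e' \in val e :\: val e' /\ same_part V (v e e') (v e' e).

Hypotheses (HU : uniform d C) (HP : complete_partite C V).

Let part_inj (j : 'I_n) p q : j \in V p -> j \in V q -> p = q.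
Proof.
case: HP => _ dis _ _ jp jq; apply/eqP/negPn/negP => /dis /disjoint_setI0.
by move=> /setP/(_ j); rewrite !inE jp jq.
Qed.

Lemma meets_part (e : circuit C) p : exists x, x \in val e :&: V p.
Proof.
case: HP => cov _ tr _; apply/set0Pn/negP => /eqP e0.
have := HU (valP e); have -> : val e = \bigcup_q (val e :&: V q).
  by rewrite -big_distrr /= cov setIT.
move/eqP; rewrite (bigD1 p) //= e0 set0U => /eqP card_e.
have le1 : (#|\bigcup_(q | q != p) (val e :&: V q)| <= \sum_(q | q != p) 1)%N.
  elim/big_ind2: _ => [|A a B b Aa Bb|q _]; first by rewrite cards0.
    by rewrite (leq_trans (leq_card_setU a b)) ?leq_add.
  exact: tr (valP e) q.
move: le1; rewrite card_e sum1_card cardC1 card_ord leqNgt ltn_predL.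
by rewrite (leq_ltn_trans (leq0n p)).
Qed.

Lemma vert_in e j : vert e j \in val e /\ same_part V (vert e j) j.
Proof.
rewrite /vert; case: pickP => [x /andP[] //|none].
case: HP => /setP/(_ j); rewrite inE => /bigcupP[p _ jp] _ _ _.
have [x /setIP[xe xp]] := meets_part e p.
by have /andP[] := none x; split=> //; apply/existsP; exists p; rewrite xp.
Qed.

Lemma vert_uniq (e : circuit C) j x :
  x \in val e -> same_part V x j -> x = vert e j.
Proof.
have [ve /existsP[p /andP[vp jp]]] := vert_in e j.
move=> xe /existsP[q /andP[xq jq]]; rewrite (part_inj jq jp) in xq.
case: HP => _ _ /(_ _ (valP e) p) /card_le1_eqP h _.
by apply: h; rewrite inE ?xe ?ve.
Qed.

Lemma val_exch e j : val (exch e j) = j |: (val e :\ vert e j).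
Proof.
rewrite val_insubd; case: ifP => // /negP[].
have [ve /existsP[p /andP[vp jp]]] := vert_in e j.
case: HP => _ _ tr all; apply: all => [|q].
  rewrite cardsU1 -[RHS](HU (valP e)) (cardsD1 (vert e j) (val e)) ve.
  rewrite !inE; case: eqVneq => [-> //|njv /=].
  case je: (j \in val e) => //; case/eqP: njv; apply: vert_uniq => //.
  by apply/existsP; exists p; rewrite jp.
have [qp|npq] := eqVneq q p.
  rewrite -(cards1 j); apply/subset_leq_card/subsetP => x.
  rewrite !inE qp => /andP[/orP[//|/andP[nxv xe]] xp].
  case/eqP: nxv; apply: vert_uniq => //; apply/existsP; exists p.
  by rewrite xp.
apply: leq_trans (tr _ (valP e) q); apply/subset_leq_card/subsetP => x.
rewrite !inE => /andP[/orP[/eqP ->|/andP[_ ->] //] jq].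
by case/eqP: npq; apply: part_inj jq jp.
Qed.

End Exchange.

(* -------------------------------------------------------------------- *)
Section CircuitIdeal.
Variables (k : closedFieldType) (n d : nat).
Variables (C : {set {set 'I_n}}) (V : 'I_d -> {set 'I_n}).
Variable (v : circuit C -> circuit C -> 'I_n).
Local Notation R := {mpoly k[n]}.

Definition xF (F : {set 'I_n}) : R := \prod_(i in F) 'X_i.

Definition circuit_ideal : R -> Prop :=
  gen_ideal (fun p => exists2 F, F \in C & p = xF F).

Definition circuit_gens (i : 'I_#|{: circuit C}|) : R :=
  xF (val (enum_val i : circuit C)).

(* R[T_e : e in C], the variable T_e being indexed by the rank of e *)
Definition circuit_poly := {mpoly R[#|{: circuit C}|]}.

HB.instance Definition _ := GRing.ComAlgebra.on circuit_poly.

Definition T (e : circuit C) : circuit_poly := 'X_(enum_rank e).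
Definition X (i : 'I_n) : circuit_poly := ('X_i)%:MP.

Inductive rel_gen : circuit_poly -> Prop :=
| rel_linear (e : circuit C) (i : 'I_n) of i \notin val e :
    rel_gen (T e * X i - X (vert V e i) * T (exch V e i))
| rel_quadric (e e' : circuit C)
    of e != e' & (#|val e' :\: val e| > 1)%N :
    let j := v e e' in let j' := v e' e in
    rel_gen (T e * T e' - T (exch V e j') * T (exch V e' j)).

Definition rel_ideal : {pred circuit_poly} :=
  fun p => `[< gen_ideal rel_gen p >].

Lemma rel_ideal_closed : idealr_closed rel_ideal.
Proof.
split.
- exact/asboolP/gen_ideal0.
- apply/negP => /asboolP h.
  have evT e : mmap idfun (fun=> 0) (T e) = 0 :> R by rewrite mmapX mmap1U.
  have : mmap idfun (fun=> 0) (1 : circuit_poly) = 0 :> R.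
    move: 1 h; apply: gen_ideal_ind.
    + by rewrite rmorph0.
    + by move=> p q p0 q0; rewrite rmorphD /= p0 q0 addr0.
    + move=> a g Gg; rewrite rmorphM /=; suff -> : mmap idfun (fun=> 0) g = 0 :> R.
        by rewrite mulr0.
      by case: Gg => [e i _|e e' _ _ j j']; rewrite rmorphB /= !rmorphM /= !evT;
        rewrite ?mulr0 ?mul0r subrr.
  by rewrite rmorph1 => /eqP; rewrite oner_eq0.
- move=> a p q /asboolP Ap /asboolP Aq; apply/asboolP.
  by apply: gen_idealD => //; apply: gen_idealM.
Qed.

HB.instance Definition _ :=
  isIdealr.Build circuit_poly rel_ideal rel_ideal_closed.

End CircuitIdeal.

Arguments circuit_ideal k {n} C _ : assert.
Arguments circuit_gens k {n} C i : assert.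
Arguments circuit_poly k {n} C : assert.
Arguments rel_ideal k {n d C} V v _ : assert.
Arguments T k {n C} e : assert.
Arguments xF k {n} F : assert.

(* Main.v *)
(** Let [phi] be the map [T_e -> x_e t]. It sends monomials to monomials, so
its kernel lies in [A] as soon as two monomials with the same image are
congruent modulo [A]. By induction on the T-degree it is enough to show that
a monomial [x^a T_e m] whose image is divisible by [x_f t] is congruent to
some [T_f m']: a vertex of [f] missing from [e] occurs either in [x^a] or in
another circuit of [m], and a linear relation or an exchange of two circuits
moves it into [e].

The exchange of [e] and [e'] in an arbitrary part must come from quadrics that
allow only one part for each pair. Circuits being ordered part by part, the
fixed vertices are chosen so that each quadric brings its pair closer to a
comparable pair, which is determined by the product [x_e x_e']. *)

Require Import Defs.
From HB Require Import structures.
From mathcomp Require Import all_boot all_order all_algebra.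
From mathcomp Require Import mpoly.
From mathcomp Require boolp.
From mathcomp Require Import zify ring.

Set Implicit Arguments.
Unset Strict Implicit.
Unset Printing Implicit Defensive.

Import GRing.Theory.

Local Open Scope ring_scope.
Local Open Scope quotient_scope.

(** * Congruence modulo a generated ideal *)

Section Congruence.
Variables (A : comNzRingType) (G : A -> Prop).
Implicit Types p q r : A.

Definition congr_mod p q := gen_ideal G (p - q).

Lemma congr_mod_refl p : congr_mod p p.
Proof. by rewrite /congr_mod subrr; apply: gen_ideal0. Qed.

Lemma congr_mod_sym p q : congr_mod p q -> congr_mod q p.
Proof.
by rewrite /congr_mod => h; rewrite -opprB -mulN1r; apply: gen_idealM.
Qed.

Lemma congr_mod_trans q p r : congr_mod p q -> congr_mod q r -> congr_mod p r.
Proof.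
by rewrite /congr_mod => pq qr; rewrite -(subrKA q); apply: gen_idealD.
Qed.

Lemma congr_modM a p q : congr_mod p q -> congr_mod (a * p) (a * q).
Proof. by rewrite /congr_mod -mulrBr; apply: gen_idealM. Qed.

Lemma congr_modMr a p q : congr_mod p q -> congr_mod (p * a) (q * a).
Proof. by rewrite ![_ * a]mulrC; apply: congr_modM. Qed.

(** Over each fiber of [key] the coefficients sum to zero, so subtracting one representative from
    every [F x] in the fiber leaves the sum unchanged and makes each term lie in the ideal. Later
    [key] is the exponent of the image monomial. *)
Lemma gen_ideal_sum_fibers (I K : eqType) (key : I -> K) (c F : I -> A) s :
    {in s &, forall x y, key x = key y -> congr_mod (F x) (F y)} ->
    (forall h, \sum_(x <- s | key x == h) c x = 0) ->
  gen_ideal G (\sum_(x <- s) c x * F x).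
Proof.
have [n] := ubnP (size s); elim: n s => // n IHn [|x0 s] sz_s FF c0.
  by rewrite big_nil; apply: gen_ideal0.
rewrite (bigID (fun x => key x == key x0)) /=; apply: gen_idealD.
  suff -> : \sum_(x <- x0 :: s | key x == key x0) c x * F x
      = \sum_(x <- x0 :: s | key x == key x0) c x * (F x - F x0).
    rewrite big_seq_cond; apply: big_ind => [||x /andP[xs /eqP kx]].
    - exact: gen_ideal0.
    - exact: gen_idealD.
    - by apply/gen_idealM/FF => //; rewrite inE eqxx.
  under [RHS]eq_bigr do rewrite mulrBr.
  by rewrite sumrB -mulr_suml c0 mul0r subr0.
rewrite -big_filter; apply: IHn.
- rewrite /= eqxx /= (leq_ltn_trans _ (ltnSE sz_s)) //.
  by rewrite size_filter count_size.
- by move=> x y; rewrite !mem_filter => /andP[_ xs] /andP[_ ys]; apply: FF.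
(* Discarding the fiber of [x0] leaves every other fiber whole. *)
- move=> h; rewrite big_filter_cond; have [->|nh] := eqVneq h (key x0).
    by rewrite big1 // => x /andP[/negbTE ->].
  rewrite -[RHS](c0 h); apply: eq_bigl => x.
  by case: (key x =P h) => [->|]; rewrite ?andbF ?nh.
Qed.

End Congruence.

(** * Circuits as functions from parts to vertices *)

Section CircuitVertices.
Variables (n d : nat) (C : {set {set 'I_n}}) (V : 'I_d -> {set 'I_n}).
Hypotheses (HU : uniform d C) (HP : complete_partite C V).
Implicit Types (e f : circuit C) (p q : 'I_d) (x : 'I_n).

Definition vx e p : 'I_n := xchoose (meets_part HU HP e p).

Lemma vx_in e p : vx e p \in val e.
Proof. by have /setIP[] := xchooseP (meets_part HU HP e p). Qed.

Lemma vx_part e p : vx e p \in V p.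
Proof. by have /setIP[] := xchooseP (meets_part HU HP e p). Qed.

Lemma part_ex x : exists p, x \in V p.
Proof.
case: HP => /setP/(_ x); rewrite inE => /bigcupP[p _ xp] _ _ _.
by exists p.
Qed.

Lemma part_uniq x p q : x \in V p -> x \in V q -> p = q.
Proof.
case: HP => _ dis _ _ xp xq; apply/eqP/negPn/negP => /dis /disjoint_setI0.
by move=> /setP/(_ x); rewrite !inE xp xq.
Qed.

Lemma same_partE x y p : x \in V p -> same_part V y x = (y \in V p).
Proof.
move=> xp; apply/existsP/idP => [[q /andP[yq xq]]|yp].
  by rewrite (part_uniq xp xq).
by exists p; rewrite yp.
Qed.

Lemma vert_vx e x p : x \in V p -> vert V e x = vx e p.
Proof.
move=> xp; apply/esym/(vert_uniq HU HP); first exact: vx_in.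
by rewrite (same_partE _ xp) vx_part.
Qed.

Lemma in_circuit e x p : x \in V p -> (x \in val e) = (x == vx e p).
Proof.
move=> xp; apply/idP/eqP => [xe|->]; last exact: vx_in.
rewrite -(vert_vx e xp); apply: (vert_uniq HU HP) => //.
by rewrite (same_partE _ xp).
Qed.

Lemma circuit_ext e f : (forall p, vx e p = vx f p) -> e = f.
Proof.
move=> ef; apply/val_inj/setP => x; have [p xp] := part_ex x.
by rewrite !(in_circuit _ xp) ef.
Qed.

Lemma vx_exch e x p q :
  x \in V p -> vx (exch V e x) q = if q == p then x else vx e q.
Proof.
move=> xp; apply/esym/eqP; have [->|nqp] := eqVneq q p.
  by rewrite -(in_circuit _ xp) (val_exch HU HP) !inE eqxx.
rewrite -(in_circuit _ (vx_part e q)) (val_exch HU HP) !inE vx_in andbT.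
rewrite (vert_vx e xp) (_ : vx e q == vx e p = false) ?orbT //.
apply/eqP => eq_v; case/eqP: nqp; apply: (@part_uniq (vx e q)).
  exact: vx_part.
by rewrite eq_v vx_part.
Qed.

(** One half of an exchange: exchanging [e] and [f] in the part [p] yields the pair [swap p e f],
    [swap p f e]. *)
Definition swap p e f := exch V e (vx f p).

Lemma vx_swap p e f q : vx (swap p e f) q = if q == p then vx f q else vx e q.
Proof. by rewrite (vx_exch _ _ (vx_part f p)); case: eqP => // ->. Qed.

Lemma vx_notin e f p : vx e p != vx f p -> vx e p \notin val f.
Proof. by move=> ef; rewrite (in_circuit _ (vx_part e p)). Qed.

(** * Comparison of circuits part by part *)

Definition less_parts e f := [set p | (vx e p < vx f p)%N].

(** Exchanging in all parts of the smaller set makes the pair comparable, so this many exchanges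
    suffice; the value is zero exactly for comparable pairs. *)
Definition inversions e f := minn #|less_parts e f| #|less_parts f e|.

(* The exchange is made in a part where the order of the two vertices is the
   less frequent one, so that the pair gets closer to a comparable one. Ties
   leave both orders eligible, which keeps the condition symmetric in [e] and
   [f]. A fixed rule such as the first part where the circuits differ fails:
   when three parts differ, it does not connect the four pairs with a given
   product. *)
Definition minority e f p :=
  (p \in less_parts e f) && (#|less_parts e f| <= #|less_parts f e|)%N
  || (p \in less_parts f e) && (#|less_parts f e| <= #|less_parts e f|)%N.

Lemma minorityC e f : minority e f =1 minority f e.
Proof. by move=> p; rewrite /minority orbC. Qed.

Lemma inversionsC e f : inversions e f = inversions f e.
Proof. exact: minnC. Qed.

Lemma less_parts_swap p e f : p \in less_parts e f ->
  less_parts (swap p e f) (swap p f e) = less_parts e f :\ p /\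
  less_parts (swap p f e) (swap p e f) = p |: less_parts f e.
Proof.
rewrite inE => pL; split; apply/setP => q; rewrite !inE !vx_swap.
  by case: (eqVneq q p) => //= ->; rewrite ltnNge ltnW.
by case: (eqVneq q p) => //= ->; rewrite pL.
Qed.

(** The exchange moves [p] from the set that is not larger to the other one, so the minimum drops by
    one. *)
Lemma inversions_swap p e f : minority e f p ->
  (inversions (swap p e f) (swap p f e) < inversions e f)%N.
Proof.
wlog: e f / (p \in less_parts e f) &&
    (#|less_parts e f| <= #|less_parts f e|)%N.
  move=> wl mp; case/orP: (mp) => ?; first exact: wl.
  rewrite (inversionsC e) (inversionsC (swap p e f)).
  by apply: wl; rewrite // minorityC.
move=> /andP[pL le_L] _; have [E1 E2] := less_parts_swap pL.
rewrite /inversions E1 E2 cardsU1 (cardsD1 p (less_parts e f)) pL.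
have -> : p \notin less_parts f e by move: pL; rewrite !inE -leqNgt => /ltnW.
by move: le_L; rewrite (cardsD1 p (less_parts e f)) pL; lia.
Qed.

Lemma inversions_minority e f :
  (0 < inversions e f)%N -> exists p, minority e f p.
Proof.
rewrite leq_min => /andP[/card_gt0P[p pL] /card_gt0P[q qL]].
have [le|/ltnW le] := leqP #|less_parts e f| #|less_parts f e|.
  by exists p; rewrite /minority pL le.
by exists q; rewrite /minority qL le orbT.
Qed.

(** Two parts with opposite orders give two vertices of [f] outside [e]. This is the side condition
    of the quadrics. *)
Lemma inversions_card e f :
  (0 < inversions e f)%N -> (1 < #|val f :\: val e|)%N.
Proof.
rewrite leq_min => /andP[/card_gt0P[p]]; rewrite inE => pL.
move=> /card_gt0P[q]; rewrite inE => qL.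
have npq : vx f p != vx f q.
  apply: contraTneq pL => eq_v.
  have -> : p = q by apply: (part_uniq (vx_part f p)); rewrite eq_v vx_part.
  by rewrite -leqNgt ltnW.
have <- : #|[set vx f p; vx f q]| = 2%N by rewrite cards2 npq.
apply/subset_leq_card/subsetP => x.
by rewrite in_set2 in_setD => /orP[] /eqP ->;
  rewrite vx_in vx_notin // -val_eqE /=; lia.
Qed.

Lemma inversions0P e f : inversions e f = 0%N ->
  (forall p, (vx e p <= vx f p)%N) \/ (forall p, (vx f p <= vx e p)%N).
Proof.
have le0 e' f' : #|less_parts e' f'| = 0%N -> forall p, (vx f' p <= vx e' p)%N.
  move=> /cards0_eq L0 p; move: L0 => /setP/(_ p).
  by rewrite !inE => /negbT; rewrite -leqNgt.
by rewrite /inversions; case: leqP => _ /le0; [right|left].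
Qed.

(** Amounts to [x_e x_e' = x_f x_f']: in each part the two pairs have the same two vertices with
    multiplicity. *)
Definition same_pair e e' f f' := forall p,
  (vx f p = vx e p /\ vx f' p = vx e' p) \/
  (vx f p = vx e' p /\ vx f' p = vx e p).

Lemma same_pair_swap p e f : same_pair e f (swap p e f) (swap p f e).
Proof. by move=> q; rewrite !vx_swap; case: eqP => _; auto. Qed.

(** In each part the smaller of the two vertices has to go to the first circuit. *)
Lemma same_pair_sorted e e' f f' : same_pair e e' f f' ->
  (forall p, (vx e p <= vx e' p)%N) -> (forall p, (vx f p <= vx f' p)%N) ->
  e = f /\ e' = f'.
Proof.
move=> ef le_e le_f; split; apply: circuit_ext => p; apply: val_inj => /=;
  have := le_e p; have := le_f p;
  by case: (ef p) => -[-> ->] // ? ?; apply/eqP; rewrite eqn_leq; apply/andP.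
Qed.

Lemma same_pair_inversions0 e e' f f' : same_pair e e' f f' ->
  inversions e e' = 0%N -> inversions f f' = 0%N ->
  (e = f /\ e' = f') \/ (e = f' /\ e' = f).
Proof.
move=> ef /inversions0P[] le_e /inversions0P[] le_f.
- by left; apply: same_pair_sorted.
- right; apply: same_pair_sorted => // p.
  by case: (ef p) => -[-> ->]; auto.
- right; have [] // := @same_pair_sorted e' e f f' => // p.
  by case: (ef p) => -[-> ->]; auto.
- left; have [] // := @same_pair_sorted e' e f' f => // p.
  by case: (ef p) => -[-> ->]; auto.
Qed.

(** * The fixed vertices *)

Section Choice.
Hypothesis d_gt0 : (0 < d)%N.

(** For a comparable pair without a minority part, any part where the circuits differ will do. The
    default is reached only when [e = f]. *)
Definition sel_part e f : 'I_d :=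
  if [pick p | minority e f p] is Some p then p
  else odflt (Ordinal d_gt0) [pick p | vx e p != vx f p].

Definition sel_vertex e f := vx e (sel_part e f).

(** [pick] depends only on the extension of its predicate, and both predicates are symmetric in the
    two circuits. *)
Lemma sel_partC e f : sel_part e f = sel_part f e.
Proof.
rewrite /sel_part (eq_pick (minorityC e f)); case: pickP => // _.
by congr odflt; apply: eq_pick => p; rewrite eq_sym.
Qed.

Lemma sel_part_minority e f :
  (0 < inversions e f)%N -> minority e f (sel_part e f).
Proof.
move=> /inversions_minority[p mp]; rewrite /sel_part.
by case: pickP => // /(_ p); rewrite mp.
Qed.

Lemma sel_part_neq e f :
  e != f -> vx e (sel_part e f) != vx f (sel_part e f).
Proof.
rewrite /sel_part; case: pickP => [p|_ /eqP ef].
  rewrite /minority !inE => /orP[] /andP[lt_v _] _.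
    by rewrite neq_ltn lt_v.
  by rewrite eq_sym neq_ltn lt_v.
case: pickP => //= eqv; case: ef; apply: circuit_ext => p.
by apply/eqP; have /negbT := eqv p; rewrite negbK.
Qed.

Lemma sel_vertex_choice : vertex_choice V sel_vertex.
Proof.
move=> e f ef; split; last first.
  rewrite /sel_vertex (sel_partC f e).
  by rewrite (same_partE _ (vx_part f _)) vx_part.
by rewrite inE vx_in vx_notin // sel_part_neq.
Qed.

End Choice.
End CircuitVertices.

(** * Monomials with the same image are congruent *)

Section Monomials.
Variables (k : closedFieldType) (n d : nat).
Variables (C : {set {set 'I_n}}) (V : 'I_d -> {set 'I_n}).
Hypotheses (d_gt0 : (0 < d)%N) (HU : uniform d C) (HP : complete_partite C V).
Implicit Types (e f : circuit C) (s : seq (circuit C)) (a : 'X_{1..n}).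

Local Notation vx := (vx HU HP).
Local Notation swap := (swap HU HP).
Local Notation congr_rel :=
  (@congr_mod (circuit_poly k C) (rel_gen V (sel_vertex HU HP d_gt0))).

(** Induction on the total number of inversions: a quadric lowers it as long as one pair is not
    comparable, and two comparable pairs with the same product coincide up to order. *)
Lemma congr_same_pair e e' f f' : same_pair HU HP e e' f f' ->
  congr_rel (T k e * T k e') (T k f * T k f').
Proof.
have [N] := ubnP (inversions HU HP e e' + inversions HU HP f f').
elim: N e e' f f' => // N IHN.
(* Congruence being symmetric, the pair with inversions may be taken to be the left one. *)
suff IH e e' f f' : (inversions HU HP e e' + inversions HU HP f f' < N.+1)%N ->
    same_pair HU HP e e' f f' -> (0 < inversions HU HP e e')%N ->
    congr_rel (T k e * T k e') (T k f * T k f').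
  move=> e e' f f' lt_N ef.
  have [e0|] := posnP (inversions HU HP e e'); last exact: IH.
  have [f0|] := posnP (inversions HU HP f f').
    have [[-> ->]|[-> ->]] := same_pair_inversions0 ef e0 f0.
      exact: congr_mod_refl.
    by rewrite mulrC; apply: congr_mod_refl.
  move=> f_gt0; apply/congr_mod_sym/IH; rewrite // 1?addnC //.
  by move=> p; case: (ef p) => -[-> ->]; auto.
move=> lt_N ef e_gt0.
set p := sel_part HU HP d_gt0 e e'.
have mp : minority HU HP e e' p by apply: sel_part_minority.
have ne : e != e'.
  apply: contraTneq e_gt0 => ->; rewrite /inversions minnn -leqNgt leqn0.
  by rewrite cards_eq0 -subset0; apply/subsetP => q; rewrite inE ltnn.
(* The exchange in the selected part is itself a defining quadric. *)
apply: (@congr_mod_trans _ _ (T k (swap p e e') * T k (swap p e' e))).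
  apply: gen_ideal_gen.
  have := @rel_quadric k _ _ _ V (sel_vertex HU HP d_gt0) e e' ne
    (inversions_card e_gt0).
  by rewrite /= /sel_vertex -(sel_partC HU HP d_gt0 e).
apply: IHN.
  by apply: leq_trans (ltnSE lt_N); rewrite ltn_add2r inversions_swap.
by move=> q; rewrite !vx_swap; case: (q =P p) => _;
  case: (ef q) => -[-> ->]; auto.
Qed.

Definition monomial a s : circuit_poly k C :=
  ('X_[a])%:MP * \prod_(e <- s) T k e.

(** The exponent of the [x]-part of the image under [T_e -> x_e t]; the exponent of [t] there is
    [size s]. *)
Definition weight a s : 'X_{1..n} :=
  [multinom (a i + count (fun e => i \in val e) s)%N | i < n].

Lemma monomial_cons a e s : monomial a (e :: s) = T k e * monomial a s.
Proof. by rewrite /monomial big_cons; apply: mulrCA. Qed.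

Lemma monomialD1 a i s : monomial (a + U_(i))%MM s = X k C i * monomial a s.
Proof. by rewrite /monomial addmC mpolyXD mpolyCM; apply/esym/mulrA. Qed.

Lemma perm_monomial a s s' : perm_eq s s' -> monomial a s = monomial a s'.
Proof. by move=> ss'; rewrite /monomial (perm_big _ ss'). Qed.

Lemma count_in_swap p e f (i : 'I_n) :
  ((i \in val (swap p e f)) + (i \in val (swap p f e)) =
   (i \in val e) + (i \in val f))%N.
Proof.
have [q iq] := part_ex HP i; rewrite !(in_circuit HU HP _ iq) !vx_swap.
by case: (q =P p) => // _; rewrite addnC.
Qed.

(** The hypothesis says that [x_f] divides the image. Induction on the number of parts where [e] and
    [f] differ. *)
Lemma congr_extract f a e s :
    (forall p, 0 < weight a (e :: s) (vx f p))%N ->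
  exists a' s', [/\ size s' = size s, weight a' (f :: s') = weight a (e :: s)
    & congr_rel (monomial a (e :: s)) (monomial a' (f :: s'))].
Proof.
have [N] := ubnP #|[set p | vx e p != vx f p]|.
elim: N e a s => // N IHN e a s lt_N w_gt0.
have [/setP E0|[p]] := set_0Vmem [set p | vx e p != vx f p].
  exists a, s; suff -> : e = f by split=> //; apply: congr_mod_refl.
  apply: (@circuit_ext _ _ _ _ HU HP) => p; apply/eqP; move: (E0 p).
  by rewrite !inE => /negbT; rewrite negbK.
rewrite inE => nef; set i := vx f p.
have iNe : i \notin val e.
  by rewrite (in_circuit HU HP _ (vx_part HU HP f p)) eq_sym.
(* It is enough to make the leading circuit agree with [f] in the part [p], keeping size, weight and
   congruence class. *)
have {}IH a' s' : size s' = size s ->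
    weight a' (swap p e f :: s') = weight a (e :: s) ->
    congr_rel (monomial a (e :: s)) (monomial a' (swap p e f :: s')) ->
  exists a' s', [/\ size s' = size s, weight a' (f :: s') = weight a (e :: s)
    & congr_rel (monomial a (e :: s)) (monomial a' (f :: s'))].
  move=> sz_s' w_s' c_s'.
  have [||a2 [s2 [sz2 w2 c2]]] := IHN (swap p e f) a' s'.
  - rewrite (leq_trans _ (ltnSE lt_N)) //.
    apply/proper_card/properP; split.
      apply/subsetP => q; rewrite !inE vx_swap.
      by case: (q =P p) => // _; rewrite eqxx.
    by exists p; rewrite !inE // vx_swap eqxx negbK.
  - by move=> q; rewrite w_s' w_gt0.
  exists a2, s2; split; [by rewrite sz2 | by rewrite w2 | ].
  exact: congr_mod_trans c_s' c2.
(* If [x_i] does not divide [x^a], the positive weight at [i] puts [i] in some other circuit [e'],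
   and [e], [e'] are exchanged in [p]. *)
have [a_i|a_i] := posnP (a i).
  have := w_gt0 p; rewrite -/i mnmE a_i /= (negbTE iNe) !add0n -has_count.
  move=> /hasP[e' e's ie'].
  have s_perm := perm_to_rem e's.
  have e'p : vx e' p = i.
    by apply/esym/eqP; rewrite -(in_circuit HU HP e' (vx_part HU HP f p)).
  have swE : swap p e e' = swap p e f by rewrite /swap e'p.
  apply: (IH a (swap p e' e :: rem e' s)).
  - by rewrite (perm_size s_perm).
  - apply/mnmP => j; rewrite !mnmE /= (permP s_perm) /= -swE.
    by congr (_ + _)%N; rewrite !addnA count_in_swap.
  rewrite (perm_monomial _ (s' := e :: e' :: rem e' s)) ?perm_cons //.
  rewrite !monomial_cons -swE (mulrA (T k e)) (mulrA (T k (swap p e e'))).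
  by apply/congr_modMr/congr_same_pair/same_pair_swap.
(* Otherwise a linear relation trades the factor [x_i] for the vertex of [e] in [p]. *)
have aE : a = (a - U_(i) + U_(i))%MM.
  by rewrite submK //; apply/mnm_lepP => j; rewrite mnm1E; case: eqP => // <-.
set b := (a - U_(i))%MM in aE.
apply: (IH (b + U_(vx e p))%MM s) => //.
  apply/mnmP => j; rewrite [in RHS]aE !mnmE /=.
  have [q jq] := part_ex HP j; rewrite !(in_circuit HU HP _ jq) !vx_swap.
  case: (eqVneq q p) => [->|nqp].
    by rewrite -/i ![_ == j]eq_sym -!addnA; congr (_ + _)%N; apply: addnCA.
  have nj g : vx g p != j.
    apply: contraNneq nqp => gp; apply/eqP/(part_uniq HP jq).
    by rewrite -gp vx_part.
  by rewrite /i !(negbTE (nj _)).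
rewrite aE !monomial_cons !monomialD1 (mulrA (T k e)) mulrA.
rewrite [X in congr_rel _ (X * _)]mulrC.
apply/congr_modMr/gen_ideal_gen.
have := @rel_linear k _ _ _ V (sel_vertex HU HP d_gt0) e i iNe.
by rewrite (vert_vx HU HP e (vx_part HU HP f p)).
Qed.

(** The first circuit [f] of the right monomial divides the common image, so it can be extracted on
    the left; induction compares the cofactors of [T_f], whose weights still agree. *)
Lemma congr_weight a a' s s' : size s = size s' ->
  weight a s = weight a' s' -> congr_rel (monomial a s) (monomial a' s').
Proof.
elim: s' a a' s => [|f s' IHs] a a' [|e s] //= sz w_eq.
  suff -> : a = a' by apply: congr_mod_refl.
  by apply/mnmP => i; move/mnmP/(_ i): w_eq; rewrite !mnmE /= !addn0.
have [p|a2 [s2 [sz2 w2 c2]]] := @congr_extract f a e s.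
  by rewrite w_eq mnmE /= vx_in addnCA add1n.
apply: congr_mod_trans c2 _.
rewrite !monomial_cons; apply/congr_modM/IHs; first by rewrite sz2; case: sz.
apply/mnmP => i; move: w2; rewrite w_eq => /mnmP/(_ i).
by rewrite !mnmE /= addnCA [RHS]addnCA => /addnI.
Qed.

End Monomials.

(** * The map onto the Rees algebra as a ring morphism *)

Section ReesMap.
Variables (k : closedFieldType) (n m : nat) (f : 'I_m -> {mpoly k[n]}).

HB.instance Definition _ := GRing.RMorphism.copy (rees_map f)
  (mmap polyC (fun i => f i *: 'X)).

Lemma rees_mapX i : rees_map f 'X_i = f i *: 'X.
Proof. by rewrite /rees_map mmapX mmap1U. Qed.

Lemma rees_mapC c : rees_map f c%:MP = c%:P.
Proof. by rewrite /rees_map mmapC. Qed.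

Lemma rees_mapZ c p : rees_map f (c *: p) = c *: rees_map f p.
Proof. by rewrite -mul_mpolyC rmorphM /= rees_mapC mul_polyC. Qed.

Lemma rees_mapMC c p : rees_map f (c%:MP * p) = c *: rees_map f p.
Proof. by rewrite mul_mpolyC rees_mapZ. Qed.

End ReesMap.

(** * Relations of the fiber ring as relations of the Rees algebra *)

Lemma mpoly_rmorph_ext (A B : comNzRingType) (m : nat)
    (g h : {rmorphism {mpoly A[m]} -> B}) :
  (forall c, g c%:MP = h c%:MP) -> (forall i, g 'X_i = h 'X_i) -> g =1 h.
Proof.
move=> ghC ghX p; rewrite [p]mpolyE !rmorph_sum; apply: eq_bigr => u _ /=.
rewrite -mul_mpolyC !rmorphM /= ghC mpolyXE_id !rmorph_prod /=; congr (_ * _).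
by apply: eq_bigr => i _; rewrite !rmorphXn /= ghX.
Qed.

Section HomogeneousFiber.
Variables (k : closedFieldType) (n m d : nat) (f : 'I_m -> {mpoly k[n]}).
Hypotheses (d_gt0 : (0 < d)%N) (f_homog : forall i, f i \is d.-homog).

Definition dilate : {mpoly k[n]} -> {poly {mpoly k[n]}} :=
  mmap (polyC \o @mpolyC n k) (fun i => 'X_i *: 'X).

HB.instance Definition _ := GRing.RMorphism.copy dilate
  (mmap (polyC \o @mpolyC n k) (fun i => 'X_i *: 'X)).

Lemma dilateC c : dilate c%:MP = c%:MP%:P.
Proof. by rewrite /dilate mmapC. Qed.

Lemma dilateX u : dilate 'X_[u] = 'X_[u] *: 'X^(mdeg u).
Proof.
rewrite /dilate mmapX /mmap1; under eq_bigr do rewrite exprZn.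
by rewrite scaler_prod -mpolyXE_id prodrXr -mdegE.
Qed.

Lemma dilate_homog p : p \is d.-homog -> dilate p = p *: 'X^d.
Proof.
move=> /dhomogP hp; rewrite [p in LHS]mpolyE rmorph_sum [p in RHS]mpolyE.
rewrite scaler_suml; apply: eq_big_seq => u /hp deg_u /=.
by rewrite -mul_mpolyC rmorphM /= dilateC dilateX mul_polyC -scalerA deg_u.
Qed.

(* Homogeneity enters here: substituting [x_i * t] for [x_i] in [h(f) = 0]
   gives [h(f * t^d) = 0], and [t -> t^d] is injective as [d > 0]. *)
Lemma fiber_ker_rees_ker h : fiber_ker f h ->
  rees_ker f (map_mpoly (@mpolyC n k) h).
Proof.
move=> h0; apply/eqP.
rewrite -(@comp_poly_eq0 _ _ 'X^d) ?size_polyXn //; apply/eqP.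
have := @mpoly_rmorph_ext k _ m
  (comp_poly 'X^d \o rees_map f \o map_mpoly (@mpolyC n k))
  (dilate \o mmap (@mpolyC n k) f).
move=> /(_ _ _ h) /= ->; first by rewrite h0 rmorph0.
  by move=> c; rewrite map_mpolyC rees_mapC comp_polyC mmapC dilateC.
move=> i; rewrite map_mpolyX rees_mapX mmapX mmap1U dilate_homog //.
by rewrite comp_polyZ comp_polyX.
Qed.

End HomogeneousFiber.

(** * The kernel of the Rees map of the circuit ideal *)

Section CircuitRees.
Variables (k : closedFieldType) (n d : nat).
Variables (C : {set {set 'I_n}}) (V : 'I_d -> {set 'I_n}).
Hypotheses (HU : uniform d C) (HP : complete_partite C V).
Implicit Types (e f : circuit C) (F : {set 'I_n}) (a : 'X_{1..n}).

Local Notation gens := (circuit_gens k C).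

Lemma xFE F : xF k F = 'X_[[multinom (i \in F : nat) | i < n]].
Proof.
rewrite mpolyXE_id /xF big_mkcond /=; apply: eq_bigr => i _.
by rewrite mnmE; case: (i \in F); rewrite ?expr1 ?expr0.
Qed.

Lemma xF_homog F : xF k F \is #|F|.-homog.
Proof.
rewrite xFE dhomogX /= mdegE -sum1_card [X in _ == X]big_mkcond /=.
by apply/eqP/eq_bigr => i _; rewrite mnmE; case: (i \in F).
Qed.

Lemma circuit_gensE e : gens (enum_rank e) = xF k (val e).
Proof. by rewrite /circuit_gens enum_rankK. Qed.

Lemma circuit_gens_homog i : gens i \is d.-homog.
Proof. by rewrite -(HU (valP (enum_val i))) xF_homog. Qed.

Lemma rees_mapT e : rees_map gens (T k e) = xF k (val e) *: 'X.
Proof. by rewrite rees_mapX circuit_gensE. Qed.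

Lemma rees_map_monomial a (s : seq (circuit C)) :
  rees_map gens (monomial k a s) = 'X_[weight a s] *: 'X^(size s).
Proof.
rewrite /monomial rees_mapMC rmorph_prod /=.
have -> : 'X_[weight a s] = 'X_[a] * \prod_(e <- s) xF k (val e)
    :> {mpoly k[n]}.
  elim: s => [|e s IHs].
    rewrite big_nil mulr1; congr 'X_[_]; apply/mnmP => i.
    by rewrite mnmE /= addn0.
  rewrite big_cons mulrCA -IHs xFE -mpolyXD; congr 'X_[_]; apply/mnmP => i.
  by rewrite !mnmE /= addnCA.
under eq_bigr do rewrite rees_mapT.
rewrite -scalerA; congr (_ *: _).
elim: s => [|e s IHs]; first by rewrite !big_nil scale1r.
by rewrite !big_cons IHs -scalerAl -scalerAr scalerA -exprS.
Qed.

(** The coefficients are scalars of [k] and the monomials involve [x] and [T] together, because only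
    such monomials are sent to monomials. Repetitions are allowed. *)
Definition combination (L : seq (k * ('X_{1..n} * seq (circuit C)))) :
    circuit_poly k C :=
  \sum_(x <- L) (x.1)%:MP%:MP * monomial k x.2.1 x.2.2.

Lemma circuit_monomialE u :
  exists s : seq (circuit C), 'X_[u] = \prod_(e <- s) T k e.
Proof.
rewrite mpolyXE_id.
apply: (@big_ind _ (fun p : circuit_poly k C =>
  exists s : seq (circuit C), p = \prod_(e <- s) T k e)).
- by exists [::]; rewrite big_nil.
- by move=> _ _ [s ->] [t ->]; exists (s ++ t); rewrite big_cat.
- move=> i _; exists (nseq (u i) (enum_val i)).
  by rewrite big_nseq iter_mulr_1 /T enum_valK.
Qed.

Lemma combination_surj p : exists L, p = combination L.
Proof.
have sumE (I : eqType) (r : seq I) (F : I -> circuit_poly k C) :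
    (forall i, exists L, F i = combination L) ->
  exists L, \sum_(i <- r) F i = combination L.
  move=> FE; apply: (@big_ind _ (fun p => exists L, p = combination L)).
  - by exists [::]; rewrite /combination big_nil.
  - by move=> _ _ [s ->] [t ->]; exists (s ++ t); rewrite /combination big_cat.
  - by move=> i _; apply: FE.
(* Expansion in the variables [T] first, then of each coefficient in the variables [x]. *)
rewrite [p]mpolyE; apply: (sumE _ _ _) => u; have [s ->] := circuit_monomialE u.
rewrite [p@_u]mpolyE scaler_suml; apply: (sumE _ _ _) => a.
exists [:: (p@_u@_a, (a, s))]; rewrite /combination big_seq1 /=.
by rewrite /monomial -[LHS]mul_mpolyC -mul_mpolyC mpolyCM -mulrA.
Qed.

Lemma rees_map_combination_coef L w r :
  ((rees_map gens (combination L))`_r)@_w =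
  \sum_(x <- L | (weight x.2.1 x.2.2, size x.2.2) == (w, r)) x.1.
Proof.
rewrite /combination rmorph_sum coef_sum raddf_sum /= [RHS]big_mkcond /=.
apply: eq_bigr => x _; rewrite rees_mapMC rees_map_monomial.
rewrite !coefZ coefXn mcoeffCM xpair_eqE [r == _]eq_sym.
case: (size _ == r); last by rewrite mulr0 mcoeff0 mulr0 andbF.
by rewrite mulr1 mcoeffX andbT; case: (_ == w); rewrite ?mulr1 ?mulr0.
Qed.

(** Terms are grouped by image monomial: each group is a single congruence class, and its
    coefficients add up to a coefficient of the image, which is zero. *)
Lemma rees_ker_rel (d_gt0 : (0 < d)%N) p : rees_ker gens p ->
  gen_ideal (rel_gen V (sel_vertex HU HP d_gt0)) p.
Proof.
have [L ->] := combination_surj p; rewrite /rees_ker => L0.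
apply: (gen_ideal_sum_fibers
  (key := fun x => (weight x.2.1 x.2.2, size x.2.2))).
  by move=> x y _ _ /pair_equal_spec[w_eq sz_eq]; apply: congr_weight.
move=> [w r]; rewrite -!rmorph_sum /=.
by rewrite -rees_map_combination_coef L0 coef0 mcoeff0 !mpolyC0.
Qed.

Lemma xF_exch e (i : 'I_n) : i \notin val e ->
  'X_(vert V e i) * xF k (val (exch V e i)) = xF k (val e) * 'X_i.
Proof.
move=> ie; rewrite (val_exch HU HP) /xF big_setU1 /=; last first.
  by rewrite !inE (negbTE ie) andbF.
have [ve _] := vert_in HU HP e i.
by rewrite [in RHS](big_setD1 _ ve) /= mulrCA mulrC.
Qed.

(** After multiplication by the two exchanged variables, the identity is the product of two linear
    ones; variables cancel in a domain. *)
Lemma xF_exch2 (v : circuit C -> circuit C -> 'I_n) e f :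
    vertex_choice V v -> e != f ->
  xF k (val e) * xF k (val f) =
  xF k (val (exch V e (v f e))) * xF k (val (exch V f (v e f))).
Proof.
move=> vP ef; have [/setDP[je jf] jj'] := vP e f ef.
have [/setDP[j'f j'e] j'j] :
    v f e \in val f :\: val e /\ same_part V (v f e) (v e f).
  by apply: vP; rewrite eq_sym.
(* The fixed vertices lie in one part, so each is the vertex that the other one replaces. *)
have := xF_exch j'e; rewrite -(vert_uniq HU HP je jj') => E1.
have := xF_exch jf; rewrite -(vert_uniq HU HP j'f j'j) => E2.
have X_neq0 i : 'X_i != 0 :> {mpoly k[n]} by rewrite -msupp_eq0 msuppX.
apply: (mulfI (X_neq0 (v f e))); apply: (mulfI (X_neq0 (v e f))).
transitivity ((xF k (val e) * 'X_(v f e)) * (xF k (val f) * 'X_(v e f))).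
  by ring.
by rewrite -E1 -E2; ring.
Qed.

(** Linear relations lie in [J_1]; quadrics have coefficients in [k] and come from [H]. *)
Lemma rel_gen_fiber_type (v : circuit C -> circuit C -> 'I_n) p :
  vertex_choice V v -> gen_ideal (rel_gen V v) p ->
  exists p1 p2, [/\ gen_ideal (rees_ker1 gens) p1,
    gen_ideal (fiber_ker_ext gens) p2 & p = p1 + p2].
Proof.
move=> vP; move: p; apply: gen_ideal_ind.
- exists 0, 0; rewrite addr0; split=> //; exact: gen_ideal0.
- move=> _ _ [p1 [p2 [J1 H2 ->]]] [q1 [q2 [J1' H2' ->]]].
  exists (p1 + q1), (p2 + q2); rewrite addrACA.
  by split; [apply: gen_idealD | apply: gen_idealD | ].
move=> c _ [e i ie|e f ef _ j j'].
  exists (c * (T k e * X k C i - X k C (vert V e i) * T k (exch V e i))), 0.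
  rewrite addr0; split=> //; last exact: gen_ideal0.
  apply/gen_idealM/gen_ideal_gen; split.
    rewrite /rees_ker rmorphB [T k e * _]mulrC /=.
    rewrite !rees_mapMC !rees_mapT !scalerA.
    by rewrite xF_exch // mulrC subrr.
  by rewrite mulrC /X !mul_mpolyC rpredB ?dhomogZ ?dhomogX /= ?mdeg1.
exists 0, (c * (T k e * T k f - T k (exch V e j') * T k (exch V f j))).
rewrite add0r; split=> //; first exact: gen_ideal0.
apply/gen_idealM/gen_ideal_gen.
pose t g : {mpoly k[#|{: circuit C}|]} := 'X_(enum_rank g).
exists (t e * t f - t (exch V e j') * t (exch V f j)).
  rewrite /fiber_ker rmorphB !rmorphM /= !mmapX !mmap1U !circuit_gensE.
  by rewrite (xF_exch2 vP ef) subrr.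
by rewrite rmorphB !rmorphM /= !map_mpolyX.
Qed.

Lemma fiber_type_rees_ker p1 p2 : (0 < d)%N ->
  gen_ideal (rees_ker1 gens) p1 -> gen_ideal (fiber_ker_ext gens) p2 ->
  rees_ker gens (p1 + p2).
Proof.
move=> d_gt0 J1 H2; rewrite /rees_ker rmorphD /=.
have ker0 G q : (forall g, G g -> rees_ker gens g) -> gen_ideal G q ->
    rees_map gens q = 0.
  move=> G0; move: q; apply: gen_ideal_ind => [||c g /G0 g0].
  - by rewrite rmorph0.
  - by move=> q q' q0 q'0; rewrite rmorphD /= q0 q'0 addr0.
  - by rewrite rmorphM /= g0 mulr0.
rewrite (ker0 _ _ _ J1) ?(ker0 _ _ _ H2) ?addr0 //; last by move=> g [].
by move=> _ [h h0 ->]; apply: fiber_ker_rees_ker d_gt0 circuit_gens_homog h h0.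
Qed.

End CircuitRees.

(** * The isomorphism, once the kernel is known *)

Section ReesIsomorphism.
Variables (k : closedFieldType) (n d : nat).
Variables (C : {set {set 'I_n}}) (V : 'I_d -> {set 'I_n}).
Variable v : circuit C -> circuit C -> 'I_n.
Hypothesis relP : forall p : circuit_poly k C,
  rees_ker (circuit_gens k C) p <-> gen_ideal (rel_gen V v) p.

Local Notation gens := (circuit_gens k C).
Local Notation I := (circuit_ideal k C).

Lemma rees_map_in p : rees_map gens p \in rees_pred I.
Proof.
rewrite [p]mpolyE rmorph_sum rpred_sum // => u _ /=.
rewrite rees_mapZ rpredZ // mpolyXE_id rmorph_prod rpred_prod // => i _ /=.
rewrite rmorphXn rpredX //= rees_mapX; apply/boolp.asboolP => j.
rewrite coefZ coefX; case: j => [|[|j]] //=; rewrite ?mulr0 ?mulr1.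
  (* [I^1] is built as the product of [I] and [I^0], the whole ring, hence the factor [1]. *)
  apply: gen_ideal_gen; exists (gens i), 1; rewrite mulr1; split=> //.
  by apply: gen_ideal_gen; exists (val (enum_val i)) => //; apply: valP.
exact: gen_ideal0.
Qed.

Lemma circuit_ideal_lift x : I x -> exists p, rees_map gens p = x *: 'X.
Proof.
move: x; apply: gen_ideal_ind => [|x y [p px] [q qy]|c _ [F FC ->]].
- by exists 0; rewrite rmorph0 scale0r.
- by exists (p + q); rewrite rmorphD /= px qy scalerDl.
by exists (c *: T k (exist _ F FC)); rewrite rees_mapZ rees_mapT scalerA.
Qed.

Lemma ideal_pow_lift i x :
  ideal_pow I i x -> exists p, rees_map gens p = x *: 'X^i.
Proof.
elim: i x => [|i IHi] x /=.
  by move=> _; exists x%:MP; rewrite rees_mapC -[LHS]mulr1 mul_polyC expr0.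
move: x; apply: gen_ideal_ind => [|x y [p px] [q qy]|c _ [x [y [Ix Iy ->]]]].
- by exists 0; rewrite rmorph0 scale0r.
- by exists (p + q); rewrite rmorphD /= px qy scalerDl.
have [p px] := circuit_ideal_lift Ix; have [q qy] := IHi y Iy.
exists (c *: (p * q)); rewrite rees_mapZ rmorphM /= px qy.
by rewrite -scalerAl -scalerAr !scalerA exprS mulrA.
Qed.

Lemma rees_map_surj q : q \in rees_pred I -> exists p, rees_map gens p = q.
Proof.
move=> /boolp.asboolP Iq; rewrite -[q]coefK poly_def.
apply: (@big_ind _ (fun q => exists p, rees_map gens p = q)).
- by exists 0; rewrite rmorph0.
- by move=> _ _ [x <-] [y <-]; exists (x + y); rewrite rmorphD.
- by move=> i _; apply: ideal_pow_lift.
Qed.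

Definition to_rees p : rees_algebra I := ReesAlgebra (rees_map_in p).

Definition quot_to_rees (q : {ideal_quot (rel_ideal k V v)}) :=
  to_rees (repr q).

(** One direction makes the map independent of representatives, the other makes it injective. *)
Lemma pi_eq p q : \pi_({ideal_quot (rel_ideal k V v)}) p = \pi q <->
  rees_map gens p = rees_map gens q.
Proof.
split=> [/eqP|pq].
  rewrite -Quotient.idealrBE => /boolp.asboolP/relP; rewrite /rees_ker rmorphB.
  by move/eqP; rewrite subr_eq0 => /eqP.
apply/eqP; rewrite -Quotient.idealrBE; apply/boolp.asboolP/relP.
by rewrite /rees_ker rmorphB /= pq subrr.
Qed.

Lemma rees_map_repr_pi p :
  rees_map gens (repr (\pi_({ideal_quot (rel_ideal k V v)}) p)) =
  rees_map gens p.
Proof. by apply/pi_eq; rewrite reprK. Qed.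

Lemma quot_to_rees_zmod : zmod_morphism quot_to_rees.
Proof.
move=> x y; apply: val_inj; rewrite -[x]reprK -[y]reprK -rmorphB /=.
by rewrite !rees_map_repr_pi rmorphB.
Qed.

Lemma quot_to_rees_monoid : monoid_morphism quot_to_rees.
Proof.
split.
  by apply: val_inj; rewrite /= -(rmorph1 \pi) rees_map_repr_pi rmorph1.
move=> x y; apply: val_inj; rewrite -[x]reprK -[y]reprK -rmorphM /=.
by rewrite !rees_map_repr_pi rmorphM.
Qed.

Lemma quot_to_rees_scalable : scalable quot_to_rees.
Proof.
move=> a x; apply: val_inj; rewrite /= -rees_mapZ.
exact: rees_map_repr_pi (a *: repr x).
Qed.

HB.instance Definition _ := GRing.isZmodMorphism.Build _ _ quot_to_rees
  quot_to_rees_zmod.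
HB.instance Definition _ := GRing.isMonoidMorphism.Build _ _ quot_to_rees
  quot_to_rees_monoid.
HB.instance Definition _ := GRing.isScalable.Build _ _ _ _ quot_to_rees
  quot_to_rees_scalable.

Lemma quot_to_rees_bij : bijective quot_to_rees.
Proof.
(* Surjectivity yields a right inverse [g]; injectivity makes it a left inverse. *)
have /boolp.choice[g gK] (y : rees_algebra I) : exists x, quot_to_rees x = y.
  have [p py] := rees_map_surj (valP y); exists (\pi p).
  by apply: val_inj; apply: etrans (rees_map_repr_pi p) py.
exists g => // x; have := gK (quot_to_rees x).
by move=> /(congr1 (@rees_val _ _)) /pi_eq; rewrite !reprK.
Qed.

Lemma rees_isomorphism :
  exists2 phi : {lrmorphism {ideal_quot (rel_ideal k V v)} -> rees_algebra I},
    bijective phi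
  & forall e : circuit C,
      rees_val (phi (\pi_({ideal_quot (rel_ideal k V v)}) (T k e)))
        = xF k (val e) *: 'X.
Proof.
exists quot_to_rees => [|e]; first exact: quot_to_rees_bij.
exact: etrans (rees_map_repr_pi (T k e)) (rees_mapT k e).
Qed.

End ReesIsomorphism.

Theorem theorem4p2 (k : closedFieldType) (n d : nat) (d_gt0 : (0 < d)%N)
    (C : {set {set 'I_n}}) (V : 'I_d -> {set 'I_n})
    (clC : is_clutter C) (unifC : uniform d C) (partC : complete_partite C V) :
  (exists2 v : circuit C -> circuit C -> 'I_n, vertex_choice V v
    & exists2 phi : {lrmorphism {ideal_quot (rel_ideal k V v)} ->
                                rees_algebra (circuit_ideal k C)},
        bijective phi
      & forall e : circuit C,
          rees_val (phi (\pi_({ideal_quot (rel_ideal k V v)}) (T k e)))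
            = xF k (val e) *: 'X)
  /\ fiber_type (circuit_gens k C).
Proof.
set v := sel_vertex unifC partC d_gt0.
have vP : vertex_choice V v := sel_vertex_choice unifC partC d_gt0.
(* The inclusions of the kernel in [A], of [A] in [S J_1 + S H], and of the latter in the kernel
   close a cycle, so all three ideals coincide and both claims follow. *)
have ker_rel (p : circuit_poly k C) :
    rees_ker (circuit_gens k C) p -> gen_ideal (rel_gen V v) p.
  exact: rees_ker_rel.
have rel_fiber (p : circuit_poly k C) :=
  @rel_gen_fiber_type k _ _ _ _ unifC partC v p vP.
have fiber_kerT p1 p2 := @fiber_type_rees_ker k _ _ _ unifC p1 p2 d_gt0.
split=> [|p].
  exists v => //; apply: rees_isomorphism => p; split=> [/ker_rel //|].
  by move=> /rel_fiber[p1 [p2 [J1 H2 ->]]]; apply: fiber_kerT.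
split=> [/ker_rel/rel_fiber //|[p1 [p2 [J1 H2 ->]]]].
exact: fiber_kerT.
Qed.
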